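(* Let $F$ be any forest on the vertex set $[n+1]$ with $l\ge 1$ edges. If $\mathcal{T}_F^{\mathcal{S}}$ is an $\mathcal{S}$-reduction tree with root labeled $F$, then the number of leaves of $\mathcal{T}_F^{\mathcal{S}}$ labeled by forests with $k$ edges, denoted by $f_{F,k}$, is a function of $F$ and $k$ only. In other words, if $P_n^{\mathcal{S}}$ is a reduced form of $m^{\mathcal{S}}[F]$, then $$P_n^{\mathcal{S}}(x_{ij}=1)=\sum_{m=0}^{l-1}f_{F,l-m}\,\beta^m.$$
   Context: Graphs have vertex set $[n+1]=\{1,\ldots,n+1\}$; an edge joining $i<j$ is written $(i,j)$. Reduction rule for graphs: given $G_0$ with $(i,j),(j,k)\in E(G_0)$, $i<j<k$, $G_0$ reduces to $G_1,G_2,G_3$ with $E(G_1)=E(G_0)\setminus\{(j,k)\}\cup\{(i,k)\}$, $E(G_2)=E(G_0)\setminus\{(i,j)\}\cup\{(i,k)\}$, $E(G_3)=E(G_0)\setminus\{(i,j)\}\setminus\{(j,k)\}\cup\{(i,k)\}$. An $\mathcal{S}$-reduction tree with root labeled $F$ is a rooted tree with nodes labeled by graphs, with root labeled $F$, in which every node whose label admits a reduction has three children labeled by the graphs $G_1,G_2,G_3$ resulting from one chosen reduction of it (for some choice of pair of edges), and whose leaves are labeled by graphs to which no reduction can be applied. $m^{\mathcal{S}}[F]=\prod_{(i,j)\in E(F)}x_{ij}$ in commuting variables $x_{ij}$, $1\le i<j\le n+1$. The reduction rule for monomials is $x_{ij}x_{jk}\to x_{ik}x_{ij}+x_{jk}x_{ik}+\beta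 x_{ik}$ for $i<j<k$ ($\beta$ a further variable), applied in one monomial of a polynomial at a time; a reduced form of a monomial is a polynomial obtained by successive applications of the rule until no monomial is divisible by any $x_{ij}x_{jk}$, $i<j<k$. *)

(* Defs.v *)
From HB Require Import structures.
From mathcomp Require Import all_boot all_order all_algebra.
From mathcomp Require Import zify mpoly.
From Stdlib Require Export Relation_Operators.

Set Implicit Arguments.
Unset Strict Implicit.
Unset Printing Implicit Defensive.

Import GRing.Theory.
Local Open Scope ring_scope.

(* The vertex set [n+1] is 'I_n.+1, i.e. vertices are numbered from 0; an edge
   is an ordered pair (i, j) with i < j and a graph is its set of edges. *)
Definition edge (n : nat) : finType :=
  {e : 'I_n.+1 * 'I_n.+1 | (e.1 < e.2)%N}.

Definition graph (n : nat) : finType := {set edge n}.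

Definition lo n (e : edge n) : 'I_n.+1 := (val e).1.
Definition hi n (e : edge n) : 'I_n.+1 := (val e).2.

(* [composable a b c]: a = (i, j), b = (j, k) and c = (i, k); the inequalities
   i < j < k are then carried by the type of a and b. *)
Definition composable n (a b c : edge n) : bool :=
  [&& hi a == lo b, lo c == lo a & hi c == hi b].

Definition adjacent n (G : graph n) : rel 'I_n.+1 :=
  fun u v => [exists e in G, (val e == (u, v)) || (val e == (v, u))].

(* No simple cycle of length at least 3. The length is bounded by n + 1 only
   to make this a boolean, see [is_forestP]. *)
Definition is_forest n (G : graph n) : bool :=
  [forall m : 'I_n.+2, forall c : m.-tuple 'I_n.+1,
     (2 < m)%N ==> ~~ ucycleb (adjacent G) c].

Lemma is_forestP n (G : graph n) :
  reflect (forall c : seq 'I_n.+1, (2 < size c)%N -> ~ ucycle (adjacent G) c)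
          (is_forest G).
Proof.
apply: (iffP idP) => [/forallP fG c c2 /= /andP[cG cu]|fG].
  have lec : (size c < n.+2)%N.
    by rewrite ltnS -[leqRHS]card_ord -(card_uniqP cu) max_card.
  have /forallP/(_ (in_tuple c)) := fG (Ordinal lec).
  by rewrite /= c2 /ucycleb /= cG cu.
apply/forallP => m; apply/forallP => c; apply/implyP => m2.
by apply/negP => /(fG c); apply; rewrite size_tuple.
Qed.

Definition red1 n (G : graph n) (a b c : edge n) : graph n := c |: (G :\ b).
Definition red2 n (G : graph n) (a b c : edge n) : graph n := c |: (G :\ a).
Definition red3 n (G : graph n) (a b c : edge n) : graph n :=
  c |: ((G :\ a) :\ b).

(* S-reduction trees with root labeled G; every leaf and every inner node is
   labeled by the index of the corresponding subtree. *)
Inductive Sred_tree n : graph n -> Type :=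
| SLeaf (G : graph n)
    (irr : forall a b c : edge n, a \in G -> b \in G -> ~~ composable a b c) :
    Sred_tree G
| SNode (G : graph n) (a b c : edge n)
    (aG : a \in G) (bG : b \in G) (abc : composable a b c)
    (T1 : Sred_tree (red1 G a b c))
    (T2 : Sred_tree (red2 G a b c))
    (T3 : Sred_tree (red3 G a b c)) :
    Sred_tree G.

Fixpoint leaf_labels n (G : graph n) (T : Sred_tree G) : seq (graph n) :=
  match T with
  | SLeaf G _ => [:: G]
  | SNode _ _ _ _ _ _ _ T1 T2 T3 =>
      leaf_labels T1 ++ leaf_labels T2 ++ leaf_labels T3
  end.

Definition nb_forest_leaves n (G : graph n) (T : Sred_tree G) (k : nat) : nat :=
  count (fun H : graph n => is_forest H && (#|H| == k)) (leaf_labels T).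

Lemma Sred_tree_inhabited n (G : graph n) : inhabited (Sred_tree G).
Proof.
pose wt (e : edge n) := (n.+1 - (hi e - lo e))%N.
pose W (H : graph n) := (\sum_(e in H) wt e)%N.
have Wadd c H : (W (c |: H) <= wt c + W H)%N.
  have [cH|cH] := boolP (c \in H); last by rewrite /W big_setU1.
  by rewrite (setUidPr _) ?sub1set // leq_addl.
have Wdel c H : (W (H :\ c) <= W H)%N.
  have [cH|cH] := boolP (c \in H); first by rewrite [leqRHS](big_setD1 c) //= leq_addl.
  by rewrite (setDidPl _) // disjoint_sym disjoints1.
have Wrep b c (H : graph n) : b \in H -> (wt c < wt b)%N -> (W (c |: H :\ b) < W H)%N.
  move=> bH cb; apply: leq_ltn_trans (Wadd _ _) _.
  by rewrite [W H](big_setD1 b) //= ltn_add2r.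
have wtc a b c : composable a b c -> (wt c < wt a)%N /\ (wt c < wt b)%N.
  move=> /and3P[/eqP ab /eqP ca /eqP cb].
  have := valP a; have := valP b; rewrite /= -/(lo a) -/(hi a) -/(lo b) -/(hi b).
  by have := ltn_ord (hi b); rewrite /wt ca cb ab; split; lia.
have [N] := ubnP (W G); elim: N G => // N IH G /ltnSE leWN.
have [/'exists_existsP[a [b /existsP[c /and3P[aG bG abc]]]]|irr] :=
  boolP [exists a, exists b, exists c,
           [&& a \in G, b \in G & @composable n a b c]]; last first.
  constructor; apply: SLeaf => a b c aG bG; apply: contra irr => abc.
  by apply/existsP; exists a; apply/existsP; exists b; apply/existsP; exists c;
     rewrite aG bG.
have [ca cb] := wtc _ _ _ abc.
have [] := IH (red1 G a b c); first by apply: leq_trans leWN; apply: Wrep.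
have [] := IH (red2 G a b c); first by apply: leq_trans leWN; apply: Wrep.
have [] := IH (red3 G a b c).
  apply: leq_trans leWN; apply: leq_ltn_trans (Wadd _ _) _.
  apply: leq_ltn_trans (_ : wt c + W (G :\ a) < _)%N.
    by rewrite leq_add2l Wdel.
  by rewrite [W G](big_setD1 a) //= ltn_add2r.
by move=> T3 T2 T1; constructor; apply: SNode aG bG abc T1 T2 T3.
Qed.

(* Z[x_e (e an edge), beta]: the variables are indexed by [option (edge n)],
   with [Some e] standing for x_e and [None] for beta. *)
Definition nvars (n : nat) : nat := #|{: option (edge n)}|.

Notation Spoly n := {mpoly int[nvars n]}.

Definition xidx n (e : edge n) : 'I_(nvars n) := enum_rank (Some e).
Definition betaidx (n : nat) : 'I_(nvars n) :=
  enum_rank (None : option (edge n)).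

Definition xvar n (e : edge n) : Spoly n := 'X_(xidx e).
Definition beta (n : nat) : Spoly n := 'X_(betaidx n).

Definition Smonomial n (F : graph n) : Spoly n := \prod_(e in F) xvar e.

(* One application of the rule, to a monomial x_a x_b w occurring in p, beta
   being allowed in w. If the coefficient of that monomial is larger than 1, the
   rule may be applied to any number d of its copies: d = p@_m rewrites the whole
   term, and smaller d treat equal monomials separately, as a reduction tree
   does. *)
Inductive Sred_step n (p : Spoly n) : Spoly n -> Prop :=
| SRedStep (a b c : edge n) (w : 'X_{1..nvars n}) (d : nat)
    (abc : composable a b c)
    (d_gt0 : (0 < d)%N)
    (d_le : d%:Z <= p@_(U_(xidx a) + U_(xidx b) + w)%MM) :
    Sred_step p
      (p - d%:Z *: (xvar a * xvar b * 'X_[w])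
         + d%:Z *: ((xvar c * xvar a + xvar b * xvar c + beta n * xvar c)
                    * 'X_[w])).

Definition Sreduced n (p : Spoly n) : Prop :=
  forall (m : 'X_{1..nvars n}) (a b c : edge n),
    m \in msupp p -> composable a b c ->
    ~~ (U_(xidx a) + U_(xidx b) <= m)%MM.

Definition Sreduced_form n (p q : Spoly n) : Prop :=
  clos_refl_trans_1n _ (@Sred_step n) p q /\ Sreduced q.

Definition eval_x1 n (p : Spoly n) : Spoly n :=
  p \mPo [tuple if enum_val i is Some _ then 1 else beta n | i < nvars n].

(* Main.v *)
(* Substitute for beta the value 1 and for x_ij the series
   y_i/y_j + (y_i/y_j)^2 + ..., the generating function of the lattice points of
   an open ray. The identity
     X(a) X(b) = X(ab) X(a) + X(b) X(ab) + X(ab),  X(t) = t / (1 - t),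
   makes every linear functional of the resulting series an invariant of the
   reduction rule. The functional used here extracts, for each N, the number of
   Laurent monomials y^p with sum of positive exponents N. In an irreducible
   monomial every vertex is either a source or a sink, so there the functional
   is the coefficient of t^N in X(t)^k, k being the number of edges. These
   numbers are unitriangular in (N, k), hence the invariants determine the number
   of leaves (or the sum of coefficients of the reduced form) with k edges.

   With z_i = y_i/y_(i+1), y_i/y_j becomes the monomial z_i ... z_(j-1), and the
   series can be truncated at degree N: a monomial in which some z_i has exponent
   larger than N has positive exponents in y of sum larger than N.

   All leaves are forests, since the property that every edge is a bridge is
   preserved by the reductions. *)
From HB Require Import structures.
Require Import Defs.
From mathcomp Require Import all_boot all_order all_algebra.
From mathcomp Require Import mpoly zify ring.

Set Implicit Arguments.
Unset Strict Implicit.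
Unset Printing Implicit Defensive.

Import GRing.Theory.
Local Open Scope ring_scope.

(** * Edges and connectivity *)

Lemma lo_lt_hi n (e : edge n) : (lo e < hi e)%N.
Proof. exact: (valP e). Qed.

Lemma edge_eqE n (e f : edge n) : (e == f) = (lo e == lo f) && (hi e == hi f).
Proof. by rewrite -val_eqE /lo /hi; case: (val e) => ? ?; case: (val f). Qed.

Lemma composable_neq n (a b c : edge n) : composable a b c ->
  [&& a != b, c != a & c != b].
Proof.
move=> /and3P[/eqP ab /eqP ca /eqP cb].
rewrite !edge_eqE ab ca cb !eqxx andbT /= !(eq_sym (hi b)).
have := lo_lt_hi a; have := lo_lt_hi b; rewrite ab -!val_eqE /=; lia.
Qed.

Lemma adjacentP n (G : graph n) u v :
  reflect (exists2 e, e \in G & (val e == (u, v)) || (val e == (v, u)))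
          (adjacent G u v).
Proof. exact: (iffP exists_inP). Qed.

Lemma adjacent_sym n (G : graph n) : ssrbool.symmetric (adjacent G).
Proof. by move=> u v; apply: eq_existsb => e; rewrite orbC. Qed.

Lemma adjacent_edge n (G : graph n) e : e \in G -> adjacent G (lo e) (hi e).
Proof.
by move=> eG; apply/adjacentP; exists e; rewrite // -surjective_pairing eqxx.
Qed.

Lemma adjacentS n (G H : graph n) : G \subset H -> subrel (adjacent G) (adjacent H).
Proof.
by move=> /subsetP GH u v /adjacentP[e /GH eH ?]; apply/adjacentP; exists e.
Qed.

Lemma connectS n (G H : graph n) : G \subset H ->
  subrel (connect (adjacent G)) (connect (adjacent H)).
Proof.
by move=> GH; apply: connect_sub => u v /(adjacentS GH)/connect1.
Qed.

Lemma connect_adjacentC n (G : graph n) : connect_sym (adjacent G).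
Proof. exact/sym_connect_sym/adjacent_sym. Qed.

(** * Forests as graphs all of whose edges are bridges, and their stability under reductions *)

Definition bridges n (G : graph n) : Prop :=
  forall e, e \in G -> ~~ connect (adjacent (G :\ e)) (lo e) (hi e).

(** A path joining the ends of [e] without using [e], once shortened, closes up with [e] to a simple
    cycle; its length is at least 3 because two vertices span at most one edge. *)
Lemma forest_bridges n (G : graph n) : is_forest G -> bridges G.
Proof.
move=> /is_forestP fG e eG; apply/negP => /connectP[p0 /shortenP[p eP uP _] lastP].
case: (fG (lo e :: p)); last first.
  rewrite /ucycle uP andbT /= rcons_path (sub_path (adjacentS (subsetDl _ _)) eP).
  by rewrite -lastP adjacent_sym adjacent_edge.
case: p eP lastP {uP} => [|x [|//]] /=.
  by move=> _ hilo; have := lo_lt_hi e; rewrite hilo ltnn.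
rewrite andbT => /adjacentP[f /setD1P[fe _] ef] hix; rewrite -hix in ef.
case/orP: ef => /eqP ef.
  by rewrite edge_eqE /lo /hi ef !eqxx in fe.
by have := lo_lt_hi f; rewrite {1}/lo {1}/hi ef /= ltnNge ltnW ?lo_lt_hi.
Qed.

(** Going the other way round a simple cycle joins the ends of its first edge without using that
    edge. *)
Lemma bridges_forest n (G : graph n) : bridges G -> is_forest G.
Proof.
move=> bG; apply/is_forestP => -[|x [|y [|z p]]] // _ /andP[/=].
move=> /and3P[/adjacentP[e eG exy] yz zp] /andP[].
rewrite !inE !negb_or => /and3P[xy xz xp] /andP[yzp _].
have exyC u v : (u == x) && (v == y) = false -> (u == y) && (v == x) = false ->
  adjacent G u v -> adjacent (G :\ e) u v.
  move=> nxy nyx /adjacentP[f fG fuv]; apply/adjacentP; exists f => //.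
  rewrite !inE fG andbT; apply/eqP => fe; move: fuv exy; rewrite fe.
  by case/orP=> /eqP-> /orP[] /eqP[uu vv]; move: nxy nyx; rewrite uu vv !eqxx.
have yx : connect (adjacent (G :\ e)) y x.
  apply/connectP; exists (z :: rcons p x); last by rewrite /= last_rcons.
  rewrite /= exyC ?(eq_sym y) ?(negPf xy) //=; last first.
    by rewrite eqxx eq_sym (negPf xz).
  have yP : all (predC1 y) (z :: rcons p x).
    rewrite -rcons_cons all_rcons; apply/andP; split=> //.
    by apply/allP => t tp /=; apply: contraTneq tp => ->; rewrite inE negb_or.
  apply: (sub_in_path (P := predC1 y)) yP zp => u v /= uy vy.
  by apply: exyC; rewrite ?(negPf uy) ?(negPf vy) ?andbF.
have := bG e eG; case/orP: exy => /eqP exy; rewrite /lo /hi exy /= ?yx //.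
by rewrite connect_adjacentC yx.
Qed.

Lemma connect_setU1 n (G : graph n) c x y :
  connect (adjacent (c |: G)) x y ->
  [|| connect (adjacent G) x y,
      connect (adjacent G) x (lo c) && connect (adjacent G) (hi c) y |
      connect (adjacent G) x (hi c) && connect (adjacent G) (lo c) y].
Proof.
case/connectP => p; elim: p x => [|z p IH] x /=; first by move=> _ ->; rewrite connect0.
case/andP=> /adjacentP[e ec exz] zp /(IH _ zp){IH zp}.
case/setU1P: ec exz => [->|eG] exz.
  case/orP: exz => /eqP exz; rewrite /lo /hi exz /=;
  by case/or3P=> [->|/andP[_ ->]|/andP[_ ->]]; rewrite ?connect0 ?orbT.
have xz : connect (adjacent G) x z by apply/connect1/adjacentP; exists e.
case/or3P=> [zy|/andP[zl ->]|/andP[zh ->]].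
- by rewrite (connect_trans xz zy).
- by rewrite (connect_trans xz zl) orbT.
- by rewrite (connect_trans xz zh) !orbT.
Qed.

Lemma bridges_sub n (G H : graph n) : H \subset G -> bridges G -> bridges H.
Proof.
move=> HG bG e eH; apply: contra (bG e (subsetP HG e eH)).
exact/connectS/setSD.
Qed.

Section Triangle.

Variables (n : nat) (G : graph n) (a b c : edge n).
Hypotheses (bG : bridges G) (aG : a \in G) (bG' : b \in G).
Hypothesis abc : composable a b c.

Let ab : hi a = lo b. Proof. by case/and3P: abc => /eqP. Qed.
Let ca : lo c = lo a. Proof. by case/and3P: abc => _ /eqP. Qed.
Let cb : hi c = hi b. Proof. by case/and3P: abc => _ _ /eqP. Qed.

(** Otherwise [a] and [c] would join the ends of the bridge [b]. *)
Lemma composable_notin : c \notin G.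
Proof.
have /and3P[anb cna cnb] := composable_neq abc.
apply/negP => cG; have /negP[] := bG bG'; rewrite -ab -cb.
apply: (@connect_trans _ _ (lo a)).
  by rewrite connect_adjacentC; apply/connect1/adjacent_edge; rewrite !inE anb.
by rewrite -ca; apply/connect1/adjacent_edge; rewrite !inE cnb.
Qed.

(* [d'] is the one of [a] and [b] that is kept. *)
Lemma bridges_replace d d' : [|| (d == a) && (d' == b) | (d == b) && (d' == a)] ->
  bridges (c |: G :\ d).
Proof.
have /and3P[anb cna cnb] := composable_neq abc.
have cG := composable_notin.
move=> dd.
have aH e : a != e -> connect (adjacent (G :\ e)) (lo a) (hi a).
  by move=> ae; apply/connect1/adjacent_edge; rewrite !inE ae.
have bH e : b != e -> connect (adjacent (G :\ e)) (lo b) (hi b).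
  by move=> be; apply/connect1/adjacent_edge; rewrite !inE be.
have abH : connect (adjacent (G :\ a :\ b)) (lo b) (hi b) = false.
  apply: contraNF (bG bG'); apply/connectS/subsetP=> x; rewrite !inE.
  by case/and3P=> -> _ ->.
have baH : connect (adjacent (G :\ a :\ b)) (lo a) (hi a) = false.
  by apply: contraNF (bG aG); apply/connectS/subsetDl.
move=> e /setU1P[->|/setD1P[ed eG]].
  have -> : (c |: G :\ d) :\ c = G :\ d.
    by rewrite setU1K // !inE (negPf cG) andbF.
  rewrite ca cb; apply/negP => ac.
  case/orP: dd => /andP[/eqP dE /eqP d'E]; rewrite {}dE {d' d'E} in ac *.
    have /negP[] := bG aG; apply: connect_trans ac _.
    by rewrite connect_adjacentC ab; apply: bH; rewrite eq_sym.
  have /negP[] := bG bG'; rewrite -ab; apply: connect_trans ac.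
  by rewrite connect_adjacentC; apply: aH.
have ce : c != e by apply: contraNneq cG => ->.
have -> : (c |: G :\ d) :\ e = c |: G :\ d :\ e.
  by apply/setP => x; rewrite !inE; case: (x =P c) => // ->; rewrite ce.
apply/negP => lh.
(* Without [a] and [b], neither of them has its ends connected, and a detour through [c] would
   connect the ends of one of them. *)
have [d'e|d'e] := eqVneq d' e.
  have dd' : G :\ d :\ e = G :\ a :\ b.
    apply/setP => x; rewrite !inE -d'e; case/orP: dd => /andP[/eqP-> /eqP->] //.
    by rewrite andbCA.
  have eab : (e == a) || (e == b).
    by rewrite -d'e; case/orP: dd => /andP[_ ->]; rewrite ?orbT.
  move: (connect_setU1 lh).
  rewrite dd' ca cb; case/orP: eab => /eqP-> /or3P[|/andP[]|/andP[]].
  - by rewrite baH.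
  - by move=> _; rewrite connect_adjacentC ab abH.
  - by move=> _; rewrite baH.
  - by rewrite abH.
  - by rewrite -ab connect_adjacentC baH.
  - by rewrite abH.
(* For any other [e], the path [a], [b] avoids [e] and can replace [c], so [e] would not be a bridge
   of [G]. *)
have [ae be] : a != e /\ b != e.
  by split; case/orP: dd ed d'e => /andP[/eqP-> /eqP->]; rewrite ![_ == e]eq_sym.
have /negP[] := bG eG; move: lh; apply: connect_sub => x y.
case/adjacentP=> f /setU1P[->|/setD1P[fe /setD1P[_ fG]]] fxy; last first.
  by apply/connect1/adjacentP; exists f; rewrite // !inE fe.
have hc : connect (adjacent (G :\ e)) (lo c) (hi c).
  by rewrite ca cb; apply: connect_trans (aH _ ae) _; rewrite ab bH.
case/orP: fxy => /eqP cxy; move: hc; rewrite /lo /hi cxy //=.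
by rewrite connect_adjacentC.
Qed.

End Triangle.

(** * Sums of positive exponents of Laurent monomials *)

Section PositiveSum.

Variable n : nat.
Implicit Types (q : 'X_{1..n.+1}) (e : edge n) (k N : nat).

(* [q] is the exponent of a monomial in the variables [z_k = y_k / y_(k+1)]; the
   exponent of [y_k] in it is [q k - flow_before q k], and [outflow q], by
   truncated subtraction, is the sum of the positive ones. *)
Definition flow_before q k : nat := if k is k'.+1 then q (inord k') else 0.

Definition outflow q : nat := \sum_(k < n.+1) (q k - flow_before q k).

Definition emon e : 'X_{1..n.+1} := [multinom ((lo e <= k < hi e)%N : nat) | k < n.+1].

Lemma emon_composable a b c : composable a b c -> emon c = (emon a + emon b)%MM.
Proof.
move=> /and3P[/eqP ab /eqP ca /eqP cb]; apply/mnmP => k.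
have := lo_lt_hi a; have := lo_lt_hi b; rewrite mnmDE !mnmE ca cb ab; lia.
Qed.

Lemma flow_beforeD q q' k :
  flow_before (q + q')%MM k = (flow_before q k + flow_before q' k)%N.
Proof. by case: k => // k; rewrite /= mnmDE. Qed.

Lemma flow_beforeMn q j k : flow_before (q *+ j)%MM k = (flow_before q k * j)%N.
Proof. by case: k => // k; rewrite /= mulmnE. Qed.

Lemma flow_before_emon e (k : 'I_n.+1) :
  flow_before (emon e) k = ((lo e < k <= hi e)%N : nat).
Proof.
case: k => -[|k] //= ltkn; rewrite mnmE inordK //; exact: ltnW.
Qed.

(** [q i] is the sum of the exponents of [y_0], ..., [y_i], and truncated subtraction only increases
    the summands. *)
Lemma leq_outflow q (i : 'I_n.+1) : (q i <= outflow q)%N.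
Proof.
pose d k := (q (inord k) - flow_before q k)%N.
have -> : outflow q = (\sum_(0 <= k < n.+1) d k)%N.
  by rewrite big_mkord; apply: eq_bigr => k _; rewrite /d inord_val.
have le_part k : (q (inord k) <= \sum_(0 <= j < k.+1) d j)%N.
  elim: k => [|k IH]; first by rewrite big_nat1 /d /= subn0.
  rewrite big_nat_recr //= {2}/d /=; move: IH; lia.
rewrite -{1}[i]inord_val (big_cat_nat (n := i.+1)) //=.
exact: leq_trans (le_part i) (leq_addr _ _).
Qed.

(* The exponents whose net flow is out of the vertices of [S] and into the other
   ones; [outflow] is additive on them. *)
Definition oriented (S : {set 'I_n.+1}) q : Prop :=
  forall k : 'I_n.+1,
    if k \in S then (flow_before q k <= q k)%N else (q k <= flow_before q k)%N.

(** A power of [y_i/y_j] changes the exponents only at [i] in [S] and at [j] outside [S], each in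
    the direction prescribed by [S], so nothing cancels. *)
Lemma oriented_edge (S : {set 'I_n.+1}) q e j :
  lo e \in S -> hi e \notin S -> oriented S q ->
  oriented S (q + emon e *+ j)%MM /\
  outflow (q + emon e *+ j)%MM = (outflow q + j)%N.
Proof.
move=> loS hiS qS; have lh := lo_lt_hi e.
have step (k : 'I_n.+1) : [/\ (q + emon e *+ j)%MM k = (q k + (lo e <= k < hi e) * j)%N
  & flow_before (q + emon e *+ j)%MM k
    = (flow_before q k + (lo e < k <= hi e) * j)%N].
  by rewrite flow_beforeD flow_beforeMn flow_before_emon mnmDE mulmnE mnmE.
have kP (k : 'I_n.+1) : [\/ k = lo e, k = hi e |
   (lo e <= k < hi e)%N = (lo e < k <= hi e)%N].
  have [->|/eqP klo] := eqVneq k (lo e); first by constructor 1.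
  have [->|/eqP khi] := eqVneq k (hi e); first by constructor 2.
  constructor 3; have {}klo : k <> lo e :> nat by move/val_inj.
  have {}khi : k <> hi e :> nat by move/val_inj.
  lia.
split=> [k|].
  have [-> ->] := step k; have := qS k.
  case: (kP k) => [->|->|->]; rewrite ?loS ?(negPf hiS) ?leqnn ?lh ?(ltnW lh) ?ltnn.
  - lia.
  - by rewrite andbF mul0n mul1n; lia.
  by case: ifP => _; rewrite leq_add2r.
rewrite /outflow (bigD1 (lo e)) //= [in RHS](bigD1 (lo e)) //=.
have -> : (\sum_(k < n.+1 | k != lo e)
    ((q + emon e *+ j)%MM k - flow_before (q + emon e *+ j)%MM k) =
    \sum_(k < n.+1 | k != lo e) (q k - flow_before q k))%N.
  apply: eq_bigr => k klo; have [-> ->] := step k.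
  case: (kP k) => [kE|->|->]; first by rewrite kE eqxx in klo.
    have := qS (hi e); rewrite (negPf hiS) ltnn andbF lh leqnn; lia.
  by rewrite subnDr.
have [-> ->] := step (lo e); have := qS (lo e).
by rewrite loS leqnn lh ltnn mul1n mul0n addn0 => le_q; rewrite -addnBAC // addnAC.
Qed.

(** Exponents of outflow [N] have all entries at most [N], so the degree bound omits none of
    them. *)
Definition outflow_coef N (p : {mpoly int[n.+1]}) : int :=
  \sum_(q : 'X_{1..n.+1 < (n.+1 * N).+1} | outflow q == N) p@_q.

Lemma outflow_coefX N q : outflow_coef N 'X_[q] = (outflow q == N)%:R.
Proof.
rewrite /outflow_coef; case: eqP => qN.
  have degq : (mdeg q < (n.+1 * N).+1)%N.
    rewrite ltnS mdegE -[in X in (_ <= X * _)%N](card_ord n.+1) -sum_nat_const.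
    by apply: leq_sum => k _; rewrite -qN leq_outflow.
  rewrite (bigD1 (BMultinom degq)) /= ?qN // mcoeffX eqxx big1 ?addr0 // => r.
  by move=> /andP[_ /negPf]; rewrite bmeqP mcoeffX eq_sym => ->.
rewrite big1 // => r /eqP rN; rewrite mcoeffX; case: eqP => // qr.
by case: qN; rewrite qr.
Qed.

Lemma outflow_coef_is_scalar N : scalar (outflow_coef N).
Proof.
move=> c p p'; rewrite /outflow_coef mulr_sumr -big_split /=.
by apply: eq_bigr => q _; rewrite mcoeffD mcoeffZ.
Qed.

HB.instance Definition _ N :=
  GRing.isLinear.Build int {mpoly int[n.+1]} int *%R (outflow_coef N)
    (outflow_coef_is_scalar N).

(** Each monomial of the product has an exponent above [N] at [lo e], hence outflow above [N]:
    truncation errors are invisible to the functional. *)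
Lemma outflow_coef_big N e p : outflow_coef N ('X_[emon e] ^+ N.+1 * p) = 0.
Proof.
rewrite [p]mpolyE mulr_sumr raddf_sum /= big1 // => q _.
rewrite -scalerAr scalarZ /= mpolyXn -mpolyXD outflow_coefX.
case: eqP => [qN|]; last by rewrite mulr0.
have := leq_outflow (emon e *+ N.+1 + q)%MM (lo e).
by rewrite qN mnmDE mulmnE mnmE leqnn lo_lt_hi mul1n; lia.
Qed.

Definition egeom N e : {mpoly int[n.+1]} := \sum_(k < N) 'X_[emon e] ^+ k.+1.

Definition geom N : {poly int} := \sum_(k < N) 'X^(k.+1).

Lemma outflow_coef_prod N (S : {set 'I_n.+1}) (mu : edge n -> nat) :
    (forall e, mu e != 0%N -> (lo e \in S) && (hi e \notin S)) ->
  outflow_coef N (\prod_e egeom N e ^+ mu e) = (geom N ^+ \sum_e mu e)`_N.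
Proof.
move=> muS.
(* The induction over the factors needs an arbitrary starting exponent [q] oriented by [S]; a
   further edge monomial to the power [k.+1] then acts like a factor ['X^(k.+1)]. *)
pose good (p : {mpoly int[n.+1]}) d := forall q, oriented S q ->
  outflow_coef N ('X_[q] * p) = ('X^(outflow q) * geom N ^+ d)`_N.
suff /(_ 0%MM) : good (\prod_e egeom N e ^+ mu e) (\sum_e mu e)%N.
  have o0 : outflow 0%MM = 0%N.
    by apply: big1 => k _; rewrite mnm0E.
  rewrite o0 mpolyX0 !mul1r; apply => k.
  have -> : flow_before 0 k = 0%N by case: (nat_of_ord k) => //= j; rewrite mnm0E.
  by rewrite mnm0E leqnn; case: ifP.
elim/big_rec2: _ => [|e d p _].
  by move=> q _; rewrite mulr1 expr0 mulr1 outflow_coefX coefXn eq_sym.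
have [-> //|mue] := eqVneq (mu e) 0%N; first by rewrite expr0 mul1r.
have /andP[loS hiS] := muS e mue.
elim: (mu e) => [|j IH] gp; first by rewrite expr0 mul1r.
move=> q qS; rewrite addSn !exprS -mulrA.
rewrite {1}/egeom mulr_suml mulr_sumr raddf_sum /=.
rewrite {1}/geom mulr_suml mulr_sumr coef_sum; apply: eq_bigr => k _.
have [qkS oqk] := oriented_edge k.+1 loS hiS qS.
by rewrite !mulrA -[_ * _ * p]mulrA mpolyXn -mpolyXD IH // oqk exprD.
Qed.

End PositiveSum.

(** * The invariants of the reduction rule *)

Section Invariant.

Variable n : nat.
Implicit Types (e a b c : edge n) (G : graph n) (N : nat).

Definition psi_subst N : (nvars n).-tuple {mpoly int[n.+1]} :=
  [tuple if enum_val i is Some e then egeom N e else 1 | i < nvars n].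

Local Notation psi N := (comp_mpoly (psi_subst N)).

Lemma tnth_psi_subst N (o : option (edge n)) :
  tnth (psi_subst N) (enum_rank o) = if o is Some e then egeom N e else 1.
Proof. by rewrite tnth_mktuple enum_rankK. Qed.

Lemma psi_xvar N e : psi N (xvar e) = egeom N e.
Proof. by rewrite comp_mpolyXU -tnth_nth tnth_psi_subst. Qed.

Lemma psi_beta N : psi N (beta n) = 1.
Proof. by rewrite comp_mpolyXU -tnth_nth tnth_psi_subst. Qed.

Lemma big_nvars (R : Type) (idx : R) (op : Monoid.com_law idx) (F : 'I_(nvars n) -> R) :
  \big[op/idx]_i F i = op (F (betaidx n)) (\big[op/idx]_e F (xidx e)).
Proof.
rewrite (reindex (@enum_rank _)) /=; last exact/onW_bij/enum_rank_bij.
rewrite (bigD1 None) //=; congr (op _ _).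
rewrite (reindex_omap Some id) => [|[]] //=.
by apply: eq_bigl => e; rewrite eqxx.
Qed.

Lemma psiX N (m : 'X_{1..nvars n}) :
  psi N 'X_[m] = \prod_e egeom N e ^+ m (xidx e).
Proof.
rewrite comp_mpolyX big_nvars /= tnth_psi_subst expr1n mul1r.
by apply: eq_bigr => e _; rewrite tnth_psi_subst.
Qed.

Lemma mdeg_nvars (m : 'X_{1..nvars n}) :
  mdeg m = (m (betaidx n) + \sum_e m (xidx e))%N.
Proof. by rewrite mdegE big_nvars. Qed.

Lemma egeom1E N e :
  (1 - 'X_[emon e]) * (1 + egeom N e) = 1 - 'X_[emon e] ^+ N.+1.
Proof.
rewrite -[RHS]opprB subrX1 -mulNr opprB; congr (_ * _).
by rewrite big_ord_recl expr0.
Qed.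

(* With [A = 1 + a + ... + a^N], [aN = a^(N+1)], and similarly for [b] and for
   [ab]: the truncated geometric series satisfy the reduction rule up to
   multiples of [a^(N+1)] and [b^(N+1)]. *)
Lemma truncated_rule (R : comNzRingType) (a b aN bN A B C : R) :
    (1 - a) * (1 + A) = 1 - aN -> (1 - b) * (1 + B) = 1 - bN ->
    (1 - a * b) * (1 + C) = 1 - aN * bN ->
  A * B - (C * A + B * C + C) =
    aN * ((1 + A) * (1 + B) * bN - (1 + C) * B) - bN * ((1 + C) * (1 + A) * a).
Proof.
move=> /eqP; rewrite -subr_eq0 => /eqP eA /eqP; rewrite -subr_eq0 => /eqP eB.
move=> /eqP; rewrite -subr_eq0 => /eqP eC; apply/eqP; rewrite -subr_eq0; apply/eqP.
transitivity
  (- (1 + A) * (1 + B) * ((1 - a * b) * (1 + C) - (1 - aN * bN))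
   + (1 + C) * (B * ((1 - a) * (1 + A) - (1 - aN))
               + a * (1 + A) * ((1 - b) * (1 + B) - (1 - bN)))); first by ring.
by rewrite eA eB eC !mulr0 addr0 mulr0 addr0.
Qed.

Definition invariant N (p : Spoly n) : int := outflow_coef N (psi N p).

Lemma invariant_is_scalar N : scalar (invariant N).
Proof. by move=> x p q; rewrite /invariant linearP scalarP. Qed.

HB.instance Definition _ N :=
  GRing.isLinear.Build int (Spoly n) int *%R (invariant N)
    (invariant_is_scalar N).

Lemma invariant_beta N p : invariant N (beta n * p) = invariant N p.
Proof. by rewrite /invariant rmorphM /= psi_beta mul1r. Qed.

(** The errors left by [truncated_rule] are multiples of [N.+1]-st powers of edge monomials, which
    the functional kills. *)
Lemma invariant_rule N a b c (w : Spoly n) : composable a b c ->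
  invariant N (xvar a * xvar b * w) =
  invariant N ((xvar c * xvar a + xvar b * xvar c + beta n * xvar c) * w).
Proof.
move=> abc; apply/eqP; rewrite -subr_eq0 -raddfB -mulrBl /= /invariant.
rewrite rmorphM rmorphB !rmorphD !rmorphM /= !psi_xvar psi_beta mul1r.
have := egeom1E N c; rewrite (emon_composable abc) mpolyXD exprMn => eC.
rewrite (truncated_rule (egeom1E N a) (egeom1E N b) eC) mulrBl -!mulrA.
by rewrite raddfB /= !outflow_coef_big subr0.
Qed.

Lemma invariant_step N p p' : Sred_step p p' -> invariant N p = invariant N p'.
Proof.
case=> a b c w d abc _ _.
by rewrite raddfD raddfB /= !scalarZ /= (invariant_rule _ _ abc) subrK.
Qed.

(** Take for [S] the lower ends of the occurring edges: an upper end lying in [S] would give a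
    composable pair. *)
Lemma outflow_coef_alternating N (mu : edge n -> nat) :
    (forall a b c, mu a != 0%N -> mu b != 0%N -> ~~ composable a b c) ->
  outflow_coef N (\prod_e egeom N e ^+ mu e) = (geom N ^+ \sum_e mu e)`_N.
Proof.
move=> alt; apply: (@outflow_coef_prod _ _ [set lo e | e in [pred e | mu e != 0%N]]).
move=> a mua; rewrite imset_f //=; apply/imsetP => -[b mub ab].
have ac : ((lo a, hi b).1 < (lo a, hi b).2)%N.
  by rewrite /= (ltn_trans (lo_lt_hi a)) // ab lo_lt_hi.
by have /negP[] := alt a b (Sub (lo a, hi b) ac) mua mub; rewrite /composable ab !eqxx.
Qed.

Lemma invariant_leaf N G :
  (forall a b c, a \in G -> b \in G -> ~~ composable a b c) ->
  invariant N (Smonomial G) = (geom N ^+ #|G|)`_N.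
Proof.
move=> irr; pose mu e : nat := e \in G.
have mu0 e : (mu e != 0%N) = (e \in G) by rewrite /mu; case: (e \in G).
rewrite -sum1_card big_mkcond /= (eq_bigr mu) => [|e _]; last first.
  by rewrite /mu; case: (e \in G).
rewrite -outflow_coef_alternating => [|a b c]; last by rewrite !mu0; apply: irr.
rewrite /invariant rmorph_prod /= big_mkcond /=; congr outflow_coef.
by apply: eq_bigr => e _; rewrite /mu psi_xvar; case: (e \in G).
Qed.

Lemma invariant_reduced N (m : 'X_{1..nvars n}) :
    (forall a b c, composable a b c -> ~~ (U_(xidx a) + U_(xidx b) <= m)%MM) ->
  invariant N 'X_[m] = (geom N ^+ (mdeg m - m (betaidx n)))`_N.
Proof.
move=> red; rewrite /invariant psiX mdeg_nvars addKn.
rewrite outflow_coef_alternating // => a b c ma mb.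
apply/negP => abc; have /negP[] := red _ _ _ abc.
apply/mnm_lepP => i; rewrite mnmDE !mnm1E.
have [<-|_] := eqVneq (xidx a) i; last first.
  by have [<-|_] := eqVneq (xidx b) i; rewrite ?lt0n.
(* Since [a] and [b] differ, the exponents in [x_a x_b] are at most 1. *)
rewrite (inj_eq (can_inj (@enum_rankK _))) (inj_eq (@Some_inj _)) eq_sym.
by case/and3P: (composable_neq abc) => /negPf-> _ _; rewrite lt0n.
Qed.

Lemma Smonomial_setU1 c G : c \notin G ->
  Smonomial (c |: G) = xvar c * Smonomial G.
Proof. exact: big_setU1. Qed.

Lemma Smonomial_setD1 c G : c \in G -> Smonomial G = xvar c * Smonomial (G :\ c).
Proof. exact: big_setD1. Qed.

(** As [c] is not in [G], the monomials of the three children are those of the rule, the third up to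
    the factor beta, which the invariant ignores. *)
Lemma tree_leaves N G (T : Sred_tree G) : bridges G ->
  invariant N (Smonomial G) = \sum_(H <- leaf_labels T) (geom N ^+ #|H|)`_N /\
  {in leaf_labels T, forall H, is_forest H /\ (#|H| <= #|G|)%N}.
Proof.
elim: T => {G} [G irr|G a b c aG bG abc T1 IH1 T2 IH2 T3 IH3] brG.
  rewrite big_seq1 invariant_leaf //; split=> // H /[!inE] /eqP->.
  by split=> //; apply: bridges_forest.
have /and3P[anb cna cnb] := composable_neq abc.
have cG := composable_notin brG aG bG abc.
have br1 : bridges (red1 G a b c).
  by apply: (bridges_replace brG aG bG abc (d' := a)); rewrite !eqxx orbT.
have br2 : bridges (red2 G a b c).
  by apply: (bridges_replace brG aG bG abc (d' := b)); rewrite !eqxx.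
have br3 : bridges (red3 G a b c).
  by apply: bridges_sub br2; rewrite /red3 setUS // subsetDl.
have [e1 f1] := IH1 br1; have [e2 f2] := IH2 br2; have [e3 f3] := IH3 br3.
have card x : x \in G -> #|c |: G :\ x| = #|G|.
  by move=> xG; rewrite cardsU1 !inE (negPf cG) andbF [RHS](cardsD1 x) xG.
have le1 : (#|red1 G a b c| <= #|G|)%N by rewrite card.
have le2 : (#|red2 G a b c| <= #|G|)%N by rewrite card.
have le3 : (#|red3 G a b c| <= #|G|)%N.
  by apply: leq_trans le2; apply/subset_leq_card/setUS/subsetDl.
split; last first.
  move=> H; rewrite /= !mem_cat => /or3P[/f1|/f2|/f3] [fH leH]; split=> //.
  - exact: leq_trans leH le1.
  - exact: leq_trans leH le2.
  - exact: leq_trans leH le3.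
rewrite /= !big_cat /= -{}e1 -{}e2 -{}e3.
rewrite !Smonomial_setU1 ?inE ?(negPf cG) ?andbF //.
have bGa : b \in G :\ a by rewrite !inE eq_sym anb.
have aGb : a \in G :\ b by rewrite !inE anb.
rewrite (Smonomial_setD1 aG) (Smonomial_setD1 bGa) (Smonomial_setD1 aGb).
have -> : G :\ b :\ a = G :\ a :\ b by rewrite !setDDl setUC.
rewrite mulrA (invariant_rule _ _ abc) !mulrDl -!mulrA !raddfD /=.
by rewrite invariant_beta [xvar b * (xvar c * _)]mulrCA addrA.
Qed.

End Invariant.

(** * Unitriangularity of the coefficients of powers of the series *)

Lemma coef_geom_exp_lt N k : (N < k)%N -> (geom N ^+ k)`_N = 0.
Proof.
move=> Nk; have -> : geom N = 'X * \sum_(i < N) 'X^i.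
  by rewrite mulr_sumr; apply: eq_bigr => i _; rewrite exprS.
by rewrite exprMn coefXnM Nk.
Qed.

Lemma coef_geom_exp_diag N : (geom N ^+ N)`_N = 1.
Proof.
case: N => [|N]; first by rewrite expr0 coef1.
have -> : geom N.+1 = 'X * \sum_(i < N.+1) 'X^i.
  by rewrite mulr_sumr; apply: eq_bigr => i _; rewrite exprS.
rewrite exprMn coefXnM ltnn subnn -horner_coef0 horner_exp.
rewrite horner_sum big_ord_recl expr0 hornerC big1 ?addr0 ?expr1n // => i _.
by rewrite hornerXn exprS mul0r.
Qed.

(* The matrix [(geom N ^+ k)`_N] is unitriangular, so these values determine the
   coefficients [d]. *)
Lemma geom_exp_inj l (d : nat -> int) :
    (forall N, \sum_(k < l) d k * (geom N ^+ k)`_N = 0) ->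
  forall k, (k < l)%N -> d k = 0.
Proof.
move=> d0; elim/ltn_ind => N IH ltNl.
have := d0 N; rewrite (bigD1 (Ordinal ltNl)) //= coef_geom_exp_diag mulr1.
rewrite big1 ?addr0 // => k kN; case: (ltngtP k N) => [ltkN|ltNk|kE].
- by rewrite IH ?mul0r.
- by rewrite coef_geom_exp_lt ?mulr0.
- by case/eqP: kN; apply: val_inj.
Qed.

(** * Homogeneity and invariants of reduced forms *)

(** The rule is homogeneous when beta has degree 1, so in a reduced form the exponent of beta
    determines the number of edge variables. *)
Lemma step_homog n l (p p' : Spoly n) :
  Sred_step p p' -> p \is l.-homog -> p' \is l.-homog.
Proof.
case=> a b c w d abc d_gt0 d_le hp.
(* The coefficient is at least [d > 0], so the rewritten monomial occurs in [p] and has degree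
   [l]. *)
have /(dhomog_mf hp) : (U_(xidx a) + U_(xidx b) + w)%MM \in msupp p.
  by rewrite mcoeff_msupp; apply: contraTneq d_le => ->; rewrite lez_nat; lia.
rewrite /= !mdegD !mdeg1 => degw.
have X1 (i : 'I_(nvars n)) : ('X_i : Spoly n) \is 1.-homog by rewrite dhomogX /= mdeg1.
have hw (q : Spoly n) : q \is 2.-homog -> q * 'X_[w] \is l.-homog.
  by move=> hq; rewrite -degw; apply: dhomogM => //; rewrite dhomogX.
have X2 (i j : 'I_(nvars n)) : ('X_i * 'X_j : Spoly n) \is 2.-homog.
  exact: (dhomogM (X1 i) (X1 j)).
apply: rpredD; first by apply: rpredB => //; apply: rpredZ; apply: hw; apply: X2.
apply: rpredZ; apply: hw; apply: rpredD (X2 _ _); apply: rpredD; apply: X2.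
Qed.

Lemma Smonomial_homog n (F : graph n) : Smonomial F \is #|F|.-homog.
Proof.
rewrite /Smonomial -sum1_card; elim/big_rec2: _ => [|e d p _ hp]; first exact: dhomog1.
by apply: dhomogM => //; rewrite dhomogX /= mdeg1.
Qed.

Lemma reduced_form_invariant n N l (p q : Spoly n) :
    clos_refl_trans_1n _ (@Sred_step n) p q -> p \is l.-homog ->
  q \is l.-homog /\ invariant N q = invariant N p.
Proof.
elim=> {p q} [//|p q r pq _ IH hp].
have [hr ->] := IH (step_homog pq hp).
by split=> //; rewrite (invariant_step _ pq).
Qed.

Lemma eval_x1X n (m : 'X_{1..nvars n}) : eval_x1 'X_[m] = beta n ^+ m (betaidx n).
Proof.
rewrite /eval_x1 comp_mpolyX big_nvars /= tnth_mktuple enum_rankK.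
by rewrite big1 ?mulr1 // => e _; rewrite tnth_mktuple enum_rankK expr1n.
Qed.

(** * Independence of the leaf counts from the tree *)

Lemma invariant_sizes (s : seq nat) N l : all (ltn^~ l) s ->
  \sum_(k <- s) (geom N ^+ k)`_N =
  \sum_(k < l) (count_mem (val k) s)%:R * (geom N ^+ k)`_N :> int.
Proof.
elim: s => [_|k s IH /= /andP[kl /IH{}IH]].
  by rewrite big_nil big1 // => k _; rewrite mul0r.
rewrite big_cons IH (bigD1 (Ordinal kl)) //= [RHS](bigD1 (Ordinal kl)) //=.
rewrite eqxx natrD mulrDl mul1r -!addrA; congr (_ + (_ + _)).
apply: eq_bigr => i; rewrite -val_eqE eq_sym /= => /negPf->.
by rewrite add0n.
Qed.

Lemma nb_forest_leavesE n (F : graph n) (T : Sred_tree F) k : bridges F ->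
  nb_forest_leaves T k = count_mem k [seq #|H : graph n| | H <- leaf_labels T].
Proof.
move=> brF; have [_ leafP] := tree_leaves 0 T brF.
rewrite count_map; apply: eq_in_count => H /leafP[fH _] /=.
by rewrite fH.
Qed.

Lemma invariant_tree n (F : graph n) (T : Sred_tree F) N : bridges F ->
  invariant N (Smonomial F) =
  \sum_(k < #|F|.+1) (nb_forest_leaves T k)%:R * (geom N ^+ k)`_N.
Proof.
move=> brF; have [-> leafP] := tree_leaves N T brF.
rewrite -(big_map (fun H : graph n => #|H|) xpredT (fun k => (geom N ^+ k)`_N)).
rewrite (@invariant_sizes _ _ #|F|.+1); last first.
  by apply/allP => _ /mapP[H /leafP[_ leH] ->]; rewrite /= ltnS.
by apply: eq_bigr => k _; rewrite nb_forest_leavesE.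
Qed.

(** Both trees expand the same invariants of [F] with a unitriangular matrix; leaves with more than
    [#|F|] edges do not exist. *)
Lemma nb_forest_leaves_unique n (F : graph n) (T T' : Sred_tree F) k :
  bridges F -> nb_forest_leaves T k = nb_forest_leaves T' k.
Proof.
move=> brF; have [lekF|ltFk] := ltnP k #|F|.+1.
  pose d k : int := (nb_forest_leaves T k)%:R - (nb_forest_leaves T' k)%:R.
  suff /eqP : d k = 0 by rewrite subr_eq0 !natz => /eqP[].
  apply: (@geom_exp_inj #|F|.+1) lekF => N.
  under eq_bigr do rewrite mulrBl.
  by rewrite sumrB -!invariant_tree // subrr.
have nb0 (T0 : Sred_tree F) : nb_forest_leaves T0 k = 0%N.
  have [_ leafP] := tree_leaves 0 T0 brF.
  apply/eqP; rewrite -leqn0 leqNgt -has_count; apply/hasPn => H /leafP[_ leH].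
  by rewrite negb_and neq_ltn (leq_ltn_trans leH) ?orbT.
by rewrite !nb0.
Qed.

(** For [N = 0] the substituted series are empty sums, so the invariant vanishes, while in its
    expansion over the leaves only the term [k = 0] survives. *)
Lemma nb_forest_leaves0 n (F : graph n) (T : Sred_tree F) :
  bridges F -> (0 < #|F|)%N -> nb_forest_leaves T 0 = 0%N.
Proof.
move=> brF /card_gt0P[e eF].
have : invariant 0 (Smonomial F) = 0.
  rewrite /invariant (Smonomial_setD1 eF) rmorphM /= psi_xvar.
  by rewrite /egeom big_ord0 mul0r raddf0.
rewrite (invariant_tree T) // big_ord_recl coef_geom_exp_diag mulr1.
by rewrite big1 ?addr0 ?natz => [[]|k _] //; rewrite coef_geom_exp_lt ?mulr0.
Qed.

(** * Coefficients of a reduced form *)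

(** The coefficient of [beta^j] once every [x_ij] is set to 1. *)
Definition beta_coef n (P : Spoly n) j : int :=
  \sum_(m <- msupp P | m (betaidx n) == j) P@_m.

(** Values in a module let the same regrouping serve for the integer invariants and for the
    evaluation at [x_ij = 1]. *)
Lemma sum_beta_coef n (V : lmodType int) l (P : Spoly n) (F : nat -> V) :
    P \is l.-homog ->
  \sum_(m <- msupp P) P@_m *: F (m (betaidx n)) =
  \sum_(j < l.+1) beta_coef P j *: F j.
Proof.
move=> hP; rewrite big_seq.
(* By homogeneity the exponent of beta is at most [l], so [inord] never takes its default value on
   the support. *)
rewrite (partition_big (fun m : 'X_{1..nvars n} => inord (m (betaidx n)) : 'I_l.+1) xpredT) //=.
have bl m : m \in msupp P -> (m (betaidx n) < l.+1)%N.
  by move=> /(dhomog_mf hP) <-; rewrite ltnS /= mdeg_nvars leq_addr.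
apply: eq_bigr => j _; rewrite /beta_coef [in RHS]big_seq_cond scaler_suml.
apply: eq_big => [m|m /andP[/bl ml /eqP <-]]; last by rewrite inordK.
have [/bl ml|//] := boolP (m \in msupp P).
by rewrite -val_eqE /= inordK.
Qed.

Lemma invariant_reduced_form n N l (P : Spoly n) :
    P \is l.-homog -> Sreduced P ->
  invariant N P = \sum_(k < l.+1) beta_coef P (l - k)%N * (geom N ^+ k)`_N.
Proof.
move=> hP redP; rewrite {1}[P]mpolyE raddf_sum /=.
have -> : \sum_(m <- msupp P) invariant N (P@_m *: 'X_[m]) =
    \sum_(m <- msupp P) P@_m *: ((geom N ^+ (l - m (betaidx n)))`_N : int^o).
  rewrite !big_seq; apply: eq_bigr => m mP.
  rewrite scalarZ /= invariant_reduced ?(dhomog_mf hP mP) //.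
  by move=> a b c; apply: redP.
rewrite (sum_beta_coef (fun j => (geom N ^+ (l - j))`_N : int^o) hP).
rewrite (reindex_inj rev_ord_inj) /=; apply: eq_bigr => k _.
by rewrite subSS subKn ?leq_ord.
Qed.

Theorem theorem10 (n : nat) :
  exists f : graph n -> nat -> nat,
    forall (F : graph n) (l : nat),
      is_forest F -> #|F| = l -> (1 <= l)%N ->
      (forall (T : Sred_tree F) (k : nat), nb_forest_leaves T k = f F k) /\
      (forall P : Spoly n,
         Sreduced_form (Smonomial F) P ->
         eval_x1 P = \sum_(0 <= m < l) (f F (l - m)%N)%:R * beta n ^+ m).
Proof.
(* The counts in one chosen tree serve as [f F]; there are finitely many graphs, so these choices
   assemble into a function. *)
have : forall F : graph n, exists fF : nat -> nat, is_forest F ->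
    forall (T : Sred_tree F) k, nb_forest_leaves T k = fF k.
  move=> F; have [T0] := Sred_tree_inhabited F.
  exists (nb_forest_leaves T0) => fF T k.
  exact/nb_forest_leaves_unique/forest_bridges.
case/fin_all_exists=> f fP.
exists f => F _ fF <- F_gt0; split=> [|P [stepP redP]]; first exact: fP.
have [T] := Sred_tree_inhabited F; have brF := forest_bridges fF.
have hF : Smonomial F \is #|F|.-homog := Smonomial_homog F.
have [hP _] := reduced_form_invariant 0 stepP hF.
(* The reduced form and the tree expand the same invariants of [F], so their coefficients agree. *)
have coefP k : (k < #|F|.+1)%N -> beta_coef P (#|F| - k)%N = (f F k)%:R.
  pose d k : int := beta_coef P (#|F| - k)%N - (f F k)%:R.
  suff d0 : (k < #|F|.+1)%N -> d k = 0 by move=> /d0/eqP; rewrite subr_eq0 => /eqP.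
  apply: geom_exp_inj => N; under eq_bigr do rewrite mulrBl -(fP F fF T).
  rewrite sumrB -invariant_reduced_form //  -invariant_tree //.
  by have [_ ->] := reduced_form_invariant N stepP hF; rewrite subrr.
rewrite {1}[P]mpolyE /eval_x1 raddf_sum /=.
under eq_bigr => m _ do rewrite comp_mpolyZ -/(eval_x1 _) eval_x1X.
rewrite (sum_beta_coef (fun j => beta n ^+ j) hP) big_ord_recr /=.
(* The top power of beta counts the leaves without edges, and there are none; hence the sum stops at
   [l - 1]. *)
have -> : beta_coef P #|F| = 0.
  by have := coefP 0 isT; rewrite subn0 -(fP F fF T) nb_forest_leaves0.
rewrite scale0r addr0 big_mkord.
apply: eq_bigr => j _; rewrite -{1}(subKn (ltnW (ltn_ord j))).
by rewrite coefP ?ltnS ?leq_subr // scaler_nat mulr_natl.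
Qed.
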